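(* Every sequence of real numbers $(u_n)_{n=0}^{\infty}$ can be represented as the difference of two convex sequences; that is, there exist convex real sequences $(x_n)_{n=0}^{\infty}$ and $(y_n)_{n=0}^{\infty}$ such that $u_n=x_n-y_n$ for all $n\in\mathbb{N}\cup\{0\}$.
   Context: $\mathbb{N}$ denotes the set of positive integers. A real sequence $(u_n)_{n=0}^{\infty}$ is called convex if $2u_n\le u_{n-1}+u_{n+1}$ for all $n\in\mathbb{N}$. *)

(* Defs.v *)
From Stdlib Require Import Reals.
Local Open Scope R_scope.

Definition convex_seq (u : nat -> R) : Prop :=
  forall n : nat, (1 <= n)%nat -> 2 * u n <= u (n - 1)%nat + u (n + 1)%nat.

(* Main.v *)
Require Import Defs.
From Stdlib Require Import Reals Lra Lia.
Open Scope R_scope.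

(** Convexity says that all second differences are nonnegative.  Let [y] be
    the sequence whose second differences are the absolute values of those of
    [u], obtained by summing them twice.  Then [y] is convex, and so is
    [x = u + y], because its second differences have the form [d + Rabs d],
    which is nonnegative for every real [d].  This is the discrete form of
    writing a function with integrable second derivative as a difference of
    two convex functions. *)

(** The index is shifted to avoid a predecessor: the value at [n] is the second
    difference centred at [S n]. *)
Definition second_difference (u : nat -> R) (n : nat) : R :=
  u (S (S n)) - 2 * u (S n) + u n.

Lemma convex_seq_of_second_difference (u : nat -> R) :
  (forall n : nat, 0 <= second_difference u n) -> convex_seq u.
Proof.
  intros H [|n] Hn; [lia|].
  replace (S n - 1)%nat with n by lia.
  replace (S n + 1)%nat with (S (S n)) by lia.
  specialize (H n); unfold second_difference in H; lra.
Qed.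

Fixpoint partial_sum (f : nat -> R) (n : nat) : R :=
  match n with
  | O => 0
  | S m => partial_sum f m + f m
  end.

(** Starting both sums from the empty one makes this hold without any shift of
    the index or boundary term. *)
Lemma second_difference_partial_sum (f : nat -> R) (n : nat) :
  second_difference (partial_sum (partial_sum f)) n = f n.
Proof. unfold second_difference; simpl; ring. Qed.

Lemma second_difference_plus (u v : nat -> R) (n : nat) :
  second_difference (fun k => u k + v k) n =
  second_difference u n + second_difference v n.
Proof. unfold second_difference; ring. Qed.

Theorem proposition1p3 (u : nat -> R) :
  exists x y : nat -> R,
    convex_seq x /\ convex_seq y /\ forall n : nat, u n = x n - y n.
Proof.
  set (y := partial_sum (partial_sum (fun n => Rabs (second_difference u n)))).
  assert (Hy : forall n, second_difference y n = Rabs (second_difference u n))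
    by (intro n; apply second_difference_partial_sum).
  exists (fun n => u n + y n), y.
  split; [|split].
  - apply convex_seq_of_second_difference; intro n.
    rewrite second_difference_plus, Hy.
    pose proof (Rle_abs (- second_difference u n)) as H.
    rewrite Rabs_Ropp in H; lra.
  - apply convex_seq_of_second_difference; intro n.
    rewrite Hy; apply Rabs_pos.
  - intro n; ring.
Qed.
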